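(* Let $N,p$ be positive integers with $p<N$, let $\mathbf{B}\in\mathbb{R}^{N\times N}$ be the (symmetric, strictly positive definite) background error covariance matrix, let $\widehat{\mathbf{R}}\in\mathbb{R}^{p\times p}$ be the (symmetric, strictly positive definite) block diagonal observation error covariance matrix, and let $\widehat{\mathbf{H}}\in\mathbb{R}^{p\times N}$ be the generalised observation operator. Let $\widehat{\mathbf{S}}=\mathbf{I}_N+\mathbf{B}^{1/2}\widehat{\mathbf{H}}^T\widehat{\mathbf{R}}^{-1}\widehat{\mathbf{H}}\mathbf{B}^{1/2}$ be the Hessian of the preconditioned 4D-Var problem. Then $$1+\max\left\{\lambda_1(\widehat{\mathbf{H}}^T\widehat{\mathbf{R}}^{-1}\widehat{\mathbf{H}})\,\lambda_N(\mathbf{B}),\ \frac{\lambda_1(\widehat{\mathbf{H}}\mathbf{B}\widehat{\mathbf{H}}^T)}{\lambda_1(\widehat{\mathbf{R}})},\ \frac{\lambda_p(\widehat{\mathbf{H}}\mathbf{B}\widehat{\mathbf{H}}^T)}{\lambda_p(\widehat{\mathbf{R}})}\right\}\le\kappa(\widehat{\mathbf{S}})$$ and $$\kappa(\widehat{\mathbf{S}})\le 1+\min\left\{\lambda_1(\mathbf{B})\,\lambda_1(\widehat{\mathbf{H}}^T\widehat{\mathbf{R}}^{-1}\widehat{\mathbf{H}}),\ \frac{\lambda_1(\widehat{\mathbf{H}}\mathbf{B}\widehat{\mathbf{H}}^T)}{\lambda_p(\widehat{\mathbf{R}})}\right\}.$$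
   Context: Setting: $n\ge 0$ is an integer; for $i=0,\dots,n$, $p_i$ is the number of observations at time $t_i$ and $p=\sum_{i=0}^n p_i$ is the total number of observations; $N$ is the number of state variables. The matrices $\mathbf{H}_i\in\mathbb{R}^{p_i\times N}$ are the linearised observation operators, $\mathbf{M}_i\in\mathbb{R}^{N\times N}$ ($i=1,\dots,n$) the linearised model operators, and $\widehat{\mathbf{M}}_i=\mathbf{M}_i\cdots\mathbf{M}_1$. The generalised observation operator is the stacked matrix $\widehat{\mathbf{H}}=\left[\mathbf{H}_0^T,(\mathbf{H}_1\widehat{\mathbf{M}}_1)^T,\dots,(\mathbf{H}_n\widehat{\mathbf{M}}_n)^T\right]^T\in\mathbb{R}^{p\times N}$. $\widehat{\mathbf{R}}\in\mathbb{R}^{p\times p}$ is block diagonal with diagonal blocks $\mathbf{R}_i\in\mathbb{R}^{p_i\times p_i}$, the observation error covariance matrices. $\mathbf{B}$ and all $\mathbf{R}_i$ (hence $\widehat{\mathbf{R}}$) are symmetric and strictly positive definite; no further structure is assumed. $\mathbf{B}^{1/2}$ is the unique symmetric positive definite square root of $\mathbf{B}$. When $n=0$, $\widehat{\mathbf{H}}=\mathbf{H}_0$ and $\widehat{\mathbf{R}}=\mathbf{R}_0$ (the 3D-Var case). Notation: for a $k\times k$ matrix $\mathbf{A}$ with real eigenvalues, $\lambda_1(\mathbf{A})\ge\lambda_2(\mathbf{A})\ge\dots\ge\lambda_k(\mathbf{A})$ are its eigenvalues in decreasing order, counted with multiplicity. For symmetric positive definite $\mathbf{A}\in\mathbb{R}^{k\times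 k}$, $\kappa(\mathbf{A})=\|\mathbf{A}\|_2\|\mathbf{A}^{-1}\|_2=\lambda_1(\mathbf{A})/\lambda_k(\mathbf{A})$ is the 2-norm condition number. *)

(* Defs.v *)
From HB Require Import structures.
From mathcomp Require Import all_boot all_order all_algebra.
From mathcomp Require Import all_classical all_reals.

Set Implicit Arguments.
Unset Strict Implicit.
Unset Printing Implicit Defensive.

Import Order.TTheory GRing.Theory Num.Theory.

Local Open Scope classical_set_scope.
Local Open Scope ring_scope.

Definition spd (R : realType) (k : nat) (A : 'M[R]_k) : Prop :=
  A^T = A /\ forall x : 'cV[R]_k, x != 0 -> 0 < (x^T *m A *m x) 0 0.

(* The eigenvalues with algebraic multiplicity, in decreasing order. Such a
   sequence exists, and is then unique, exactly when the characteristic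
   polynomial splits over R; otherwise the value is the empty sequence. *)
Definition eigenvalues (R : realType) (k : nat) (A : 'M[R]_k) : seq R :=
  xget [::] [set s : seq R | sorted (fun x y : R => y <= x) s /\
                             char_poly A = \prod_(a <- s) ('X - a%:P)].

(* lambda j A is the j-th largest eigenvalue, with j counted from 1. *)
Definition lambda (R : realType) (j : nat) (k : nat) (A : 'M[R]_k) : R :=
  nth 0 (eigenvalues A) j.-1.

Definition vnorm2 (R : realType) (k : nat) (x : 'cV[R]_k) : R :=
  Num.sqrt (\sum_(i < k) x i 0 ^+ 2).

(* Spectral norm: the operator norm induced by vnorm2 (meaningful for 0 < n). *)
Definition mxnorm2 (R : realType) (m n : nat) (A : 'M[R]_(m, n)) : R :=
  sup [set vnorm2 (A *m x) | x in [set x : 'cV[R]_n | vnorm2 x = 1]].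

Definition cond2 (R : realType) (k : nat) (A : 'M[R]_k) : R :=
  mxnorm2 A * mxnorm2 (invmx A).

(* The symmetric positive definite square root; 0 if there is none. *)
Definition spd_sqrt (R : realType) (k : nat) (A : 'M[R]_k) : 'M[R]_k :=
  xget 0 [set C : 'M[R]_k | spd C /\ C *m C = A].

(* model_prod M i = M_i ... M_1, the identity for i = 0; M 0 is never used. *)
Fixpoint model_prod (R : realType) (N : nat) (M : nat -> 'M[R]_N) (i : nat)
    : 'M[R]_N :=
  if i is i'.+1 then M i *m model_prod M i' else 1%:M.

Definition gen_obs_op (R : realType) (N n : nat) (p_ : 'I_n.+1 -> nat)
    (H : forall i : 'I_n.+1, 'M[R]_(p_ i, N)) (M : nat -> 'M[R]_N)
    : 'M[R]_(\sum_(i < n.+1) p_ i, N) :=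
  \mxcol_(i < n.+1) (H i *m model_prod M i).

Definition gen_obs_cov (R : realType) (n : nat) (p_ : 'I_n.+1 -> nat)
    (Robs : forall i : 'I_n.+1, 'M[R]_(p_ i)) : 'M[R]_(\sum_(i < n.+1) p_ i) :=
  \mxdiag_(i < n.+1) Robs i.

Definition precond_hessian (R : realType) (N p : nat) (B : 'M[R]_N)
    (Rh : 'M[R]_p) (Hh : 'M[R]_(p, N)) : 'M[R]_N :=
  1%:M + spd_sqrt B *m Hh^T *m invmx Rh *m Hh *m spd_sqrt B.

(* Main.v *)
Require Import Defs.
From HB Require Import structures.
From mathcomp Require Import all_boot all_order all_algebra.
From mathcomp Require Import all_classical all_reals.
From mathcomp Require Import complex ring lra.

Set Implicit Arguments.
Unset Strict Implicit.
Unset Printing Implicit Defensive.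

Import Order.TTheory GRing.Theory Num.Theory.
Local Open Scope ring_scope.

(** Write S = 1 + L G L with L = B^(1/2) and G = H^T Rh^-1 H, and let
    K = H B H^T. The matrix S is symmetric positive definite, so its condition
    number is the quotient of its extreme eigenvalues ([cond2_spd]). Since S
    exceeds the identity by a positive semidefinite term, and since H L has a
    nonzero kernel when p < N, the smallest eigenvalue of S is exactly 1
    ([hessian_lambda_min]). Hence the condition number is 1 + mu, where mu is
    the largest eigenvalue of L G L, and the theorem becomes five inequalities
    on mu.

    All five follow from the Rayleigh bounds
    lambda_min |x|^2 <= x^T A x <= lambda_max |x|^2, with equality at
    eigenvectors. The two that involve G and B evaluate
    x^T L G L x = (L x)^T G (L x), where |L x|^2 = x^T B x, at the eigenvector
    of L G L ([mu_le_product]), or at L^-1 u for the top eigenvector u of G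
    ([product_le_mu]).

    The other three compare K with Rh. The key inequality
    y^T K y <= mu y^T Rh y ([outer_form_le]) says that mu bounds the
    generalised eigenvalues of the pair (K, Rh); it is a Cauchy-Schwarz
    inequality for the form Rh. Evaluating it at the top eigenvector of K gives
    [outer_lambda1_le], and at the bottom eigenvector of Rh gives
    [outer_lambdap_le]. Conversely, y = Rh^-1 H L v, for v the eigenvector of
    L G L, attains equality, which gives [mu_le_outer].

    The foundation is the spectral theorem for real symmetric matrices
    ([symmetric_spectral]). A real eigenvector is extracted from a complex one,
    and a Householder reflection splits it off, so that induction on the size
    applies. Orthogonal diagonalisation shows that the eigenvalue sequence
    exists and what its extreme terms are, and it gives the square root of B. *)

(** * The Euclidean inner product *)

Definition dot {R : realDomainType} {k : nat} (x y : 'cV[R]_k) : R :=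
  (x^T *m y) 0 0.

Section Dot.
Context {R : realDomainType}.
Implicit Types k : nat.

Lemma dotE k (x y : 'cV[R]_k) : dot x y = \sum_i x i 0 * y i 0.
Proof. by rewrite /dot mxE; apply: eq_bigr => i _; rewrite mxE. Qed.

Lemma dotC k (x y : 'cV[R]_k) : dot x y = dot y x.
Proof. by rewrite !dotE; apply: eq_bigr => i _; rewrite mulrC. Qed.

Lemma dotDl k (x y z : 'cV[R]_k) : dot (x + y) z = dot x z + dot y z.
Proof. by rewrite !dotE -big_split; apply: eq_bigr => i _; rewrite mxE mulrDl. Qed.

Lemma dotDr k (x y z : 'cV[R]_k) : dot z (x + y) = dot z x + dot z y.
Proof. by rewrite !(dotC z) dotDl. Qed.

Lemma dotZl k (a : R) (x y : 'cV[R]_k) : dot (a *: x) y = a * dot x y.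
Proof. by rewrite !dotE mulr_sumr; apply: eq_bigr => i _; rewrite mxE mulrA. Qed.

Lemma dotZr k (a : R) (x y : 'cV[R]_k) : dot x (a *: y) = a * dot x y.
Proof. by rewrite dotC dotZl dotC. Qed.

Lemma dotBl k (x y z : 'cV[R]_k) : dot (x - y) z = dot x z - dot y z.
Proof. by rewrite -scaleN1r dotDl dotZl mulN1r. Qed.

Lemma dotBr k (x y z : 'cV[R]_k) : dot z (x - y) = dot z x - dot z y.
Proof. by rewrite !(dotC z) dotBl. Qed.

Lemma dot0l k (x : 'cV[R]_k) : dot 0 x = 0.
Proof. by rewrite dotE big1 // => i _; rewrite mxE mul0r. Qed.

Lemma dot_mulmxl m k (A : 'M[R]_(m, k)) x y :
  dot (A *m x) y = dot x (A^T *m y).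
Proof. by rewrite /dot trmx_mul mulmxA. Qed.

Lemma dot_ge0 k (x : 'cV[R]_k) : 0 <= dot x x.
Proof. by rewrite dotE; apply: sumr_ge0 => i _; rewrite -expr2 sqr_ge0. Qed.

Lemma dot_eq0 k (x : 'cV[R]_k) : (dot x x == 0) = (x == 0).
Proof.
apply/eqP/eqP => [|->]; last by rewrite dot0l.
rewrite dotE => /psumr_eq0P H; apply/colP => i; rewrite mxE; apply/eqP.
by rewrite -sqrf_eq0 expr2 H// => j _; rewrite -expr2 sqr_ge0.
Qed.

Lemma dot_gt0 k (x : 'cV[R]_k) : (0 < dot x x) = (x != 0).
Proof. by rewrite lt_def dot_ge0 andbT dot_eq0. Qed.

End Dot.

(** * The spectral theorem for real symmetric matrices *)

(** Over the algebraic closure R[i] there is an eigenvector x + i y, for an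
    eigenvalue a + i b. Symmetry gives <A x, y> = <x, A y>, which reads
    b (|x|^2 + |y|^2) = 0. So b = 0, and whichever of x and y is nonzero is a
    real eigenvector. *)
Lemma symmetric_eigenvector (R : rcfType) k (A : 'M[R]_k) :
  (0 < k)%N -> A^T = A -> exists (a : R) (v : 'cV[R]_k), v != 0 /\ A *m v = a *: v.
Proof.
move=> k0 sA.
have [z /eigenvalueP [v vA v0]] := eigenvalue_closed (map_mx (real_complex R) A) k0.
pose x : 'cV[R]_k := \col_i complex.Re (v 0 i).
pose y : 'cV[R]_k := \col_i complex.Im (v 0 i).
have AE i j : A i j = A j i by rewrite -{1}sA mxE.
have ReIm i : complex.Re (z * v 0 i) = complex.Re z * x i 0 - complex.Im z * y i 0
   /\ complex.Im (z * v 0 i) = complex.Im z * x i 0 + complex.Re z * y i 0.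
  rewrite !mxE; case: (z) => a b; case: (v 0 i) => c d /=; split=> //.
  by rewrite addrC.
have vAi i : \sum_j v 0 j * (A j i)%:C%C = z * v 0 i.
  have := congr1 (fun w : 'rV_k => w 0 i) vA; rewrite !mxE => <-.
  by apply: eq_bigr => j _; rewrite !mxE.
have Ax : A *m x = complex.Re z *: x - complex.Im z *: y.
  apply/colP => i; have [E _] := ReIm i; rewrite !mxE in E *.
  rewrite -E -vAi raddf_sum; apply: eq_bigr => j _.
  rewrite AE !mxE; case: (v 0 j) => c d /=; ring.
have Ay : A *m y = complex.Im z *: x + complex.Re z *: y.
  apply/colP => i; have [_ E] := ReIm i; rewrite !mxE in E *.
  rewrite -E -vAi raddf_sum; apply: eq_bigr => j _.
  rewrite AE !mxE; case: (v 0 j) => c d /=; ring.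
have xy0 : 0 < dot x x + dot y y.
  rewrite lt_def addr_ge0 ?dot_ge0// andbT paddr_eq0 ?dot_ge0// !dot_eq0.
  apply: contra v0 => /andP [/eqP x0 /eqP y0]; apply/eqP/rowP => i.
  have := congr1 (fun w : 'cV_k => w i 0) x0; rewrite !mxE.
  have := congr1 (fun w : 'cV_k => w i 0) y0; rewrite !mxE.
  by case: (v 0 i) => c d /= -> ->.
have z0 : complex.Im z = 0.
  have := dot_mulmxl A x y; rewrite sA Ax Ay.
  rewrite dotBl dotDr !dotZl !dotZr => H.
  have : complex.Im z * (dot x x + dot y y) = 0 by lra.
  by move/eqP; rewrite mulf_eq0 (gt_eqF xy0) orbF => /eqP.
rewrite z0 in Ax Ay; exists (complex.Re z).
have [x0|x0] := eqVneq x 0; last by exists x; rewrite Ax scale0r subr0.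
exists y; rewrite Ay scale0r add0r; split => //.
by move: xy0; rewrite x0 dot0l add0r dot_gt0.
Qed.

(** Q is the reflection in the hyperplane orthogonal to u - v, which bisects u
    and v because their lengths agree. *)
Lemma householder (R : realFieldType) k (u v : 'cV[R]_k) :
  dot u u = dot v v -> exists Q : 'M[R]_k, [/\ Q^T = Q, Q *m Q = 1%:M & Q *m u = v].
Proof.
move=> uv; have [w wE] : exists w, w = u - v by exists (u - v).
have [/eqP|w0] := eqVneq w 0.
  by rewrite wE subr_eq0 => /eqP->; exists 1%:M; rewrite trmx1 !mul1mx.
pose c := 2 / dot w w; have w0' : dot w w != 0 by rewrite dot_eq0.
have ww x : (w *m w^T) *m x = dot w x *: w.
  rewrite -mulmxA [w^T *m x]mx11_scalar mul_mx_scalar //.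
pose Q := 1%:M - c *: (w *m w^T).
have Qx x : Q *m x = x - (c * dot w x) *: w.
  by rewrite mulmxBl mul1mx -scalemxAl ww scalerA.
exists Q; split.
- by rewrite linearB linearZ /= trmx1 trmx_mul trmxK.
- have PP : w *m w^T *m (w *m w^T) = dot w w *: (w *m w^T).
    by rewrite mulmxA ww -scalemxAl.
  rewrite /Q mulmxBr mulmx1 mulmxBl mul1mx -scalemxAl -scalemxAr PP !scalerA.
  by apply/matrixP => i j; rewrite !mxE /c; field.
- have ww2 : dot w w = 2 * dot w u.
    by rewrite wE !dotBl !dotBr -uv (dotC v u); ring.
  have c1 : c * dot w u = 1 by rewrite /c mulrAC -ww2 divff.
  by rewrite Qx c1 scale1r wE subKr.
Qed.

(** A reflection Q that exchanges a unit eigenvector with the first basis vector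
    makes the first column of Q A Q a multiple of that basis vector. By symmetry
    so is the first row, and the induction applies to the remaining block. *)
Theorem symmetric_spectral (R : rcfType) k (A : 'M[R]_k) : A^T = A ->
  exists (P : 'M[R]_k) (d : 'rV[R]_k),
    P^T *m P = 1%:M /\ A = P^T *m diag_mx d *m P.
Proof.
elim: k A => [|k IH] A sA.
  by exists 1%:M, 0; split; apply/matrixP => -[].
have [//|a [v [v0 Av]]] := symmetric_eigenvector _ sA.
pose e : 'cV[R]_(1 + k) := delta_mx 0 0.
pose u := (Num.sqrt (dot v v))^-1 *: v.
have vv : 0 < dot v v by rewrite dot_gt0.
have uu : dot u u = dot e e.
  rewrite dotZl dotZr mulrA -invfM -expr2 sqr_sqrtr ?ltW// mulVf ?gt_eqF//.
  rewrite dotE (bigD1 0)//= big1 ?addr0 => [|i /negPf i0]; rewrite !mxE ?eqxx ?mulr1//.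
  by rewrite i0 mulr0.
have Au : A *m u = a *: u by rewrite -scalemxAr Av !scalerA mulrC.
have [Q [sQ QQ Qu]] := householder uu.
have Qe : Q *m e = u by rewrite -Qu mulmxA QQ mul1mx.
have [A1 A1D] : exists A1 : 'M[R]_(1 + k), A1 = Q *m A *m Q by exists (Q *m A *m Q).
have sA1 : A1^T = A1 by rewrite A1D !trmx_mul sA sQ mulmxA.
have A1e : A1 *m e = a *: e by rewrite A1D -!mulmxA Qe Au -scalemxAr Qu.
have A1col i : A1 i 0 = a * e i 0.
  have := congr1 (fun w : 'cV_(1 + k) => w i 0) A1e.
  by rewrite -colE !mxE.
have A1ul : ulsubmx A1 = a%:M.
  apply/matrixP => i j; rewrite !ord1 !mxE.
  have -> : lshift k (0 : 'I_1) = 0 by apply: val_inj.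
  by rewrite A1col ?mxE ?eqxx ?mulr1.
have A1dl : dlsubmx A1 = 0.
  apply/matrixP => i j; rewrite !ord1 !mxE.
  have -> : lshift k (0 : 'I_1) = 0 by apply: val_inj.
  by rewrite A1col ?mxE ?mulr0.
have A1ur : ursubmx A1 = 0 by rewrite -[A1]sA1 -trmx_dlsub A1dl trmx0.
have [P2 [d2 [PP2 A2]]] : exists (P : 'M[R]_k) (d : 'rV[R]_k),
    P^T *m P = 1%:M /\ drsubmx A1 = P^T *m diag_mx d *m P.
  by apply: IH; rewrite trmx_drsub sA1.
pose P : 'M[R]_(1 + k) := block_mx 1%:M 0 0 P2.
have A1E : A1 = P^T *m diag_mx (row_mx a%:M d2) *m P.
  rewrite -[LHS]submxK A1ul A1dl A1ur A2.
  rewrite diag_mx_row /P tr_block_mx !mulmx_block.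
  rewrite !trmx0 !trmx1 !(mul0mx, mulmx0, mul1mx, mulmx1, addr0, add0r).
  by congr block_mx; apply/matrixP => i j; rewrite !ord1 !mxE eqxx.
have PTP : P^T *m P = 1%:M.
  rewrite /P tr_block_mx mulmx_block.
  rewrite !trmx0 !trmx1 !(mul0mx, mulmx0, mul1mx, mulmx1, addr0, add0r) PP2.
  by rewrite -scalar_mx_block.
exists (P *m Q), (row_mx a%:M d2); split.
  by rewrite trmx_mul sQ mulmxA -(mulmxA Q) PTP mulmx1.
rewrite trmx_mul sQ !mulmxA -3!(mulmxA Q) -A1E A1D.
by rewrite !mulmxA QQ mul1mx -mulmxA QQ mulmx1.
Qed.

(** * Eigenvalues and Rayleigh bounds *)

Lemma char_poly_orthogonal_diag (R : comUnitRingType) k (P : 'M[R]_k) (d : 'rV[R]_k) :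
  P^T *m P = 1%:M ->
  char_poly (P^T *m diag_mx d *m P) = \prod_(i < k) ('X - (d 0 i)%:P).
Proof.
move=> PP; transitivity (char_poly (diag_mx d)); last first.
  rewrite char_poly_trig ?diag_mx_is_trig//.
  by apply: eq_bigr => i _; rewrite mxE eqxx.
have PPC : map_mx polyC P^T *m map_mx polyC P = 1%:M :> 'M[{poly R}]_k.
  by rewrite -map_mxM PP map_mx1.
rewrite /char_poly /char_poly_mx !map_mxM /=.
set P1 := map_mx _ P^T in PPC *; set P2 := map_mx _ P in PPC *.
have XE : 'X%:M = P1 *m 'X%:M *m P2 by rewrite scalar_mxC -mulmxA PPC mulmx1.
rewrite [in LHS]XE -mulmxBl -mulmxBr !det_mulmx.
by rewrite mulrAC -det_mulmx PPC det1 mul1r.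
Qed.

Section Spectrum.
Context {R : realType} {k : nat}.
Implicit Types (A P : 'M[R]_k) (d : 'rV[R]_k) (x : 'cV[R]_k).

Definition diagonalizes P d A := P^T *m P = 1%:M /\ A = P^T *m diag_mx d *m P.

(** The diagonal entries, once sorted, witness that the sequence chosen by
    [eigenvalues] is a genuine factorisation of the characteristic polynomial;
    comparing degrees and roots then relates it to the diagonal. *)
Lemma diagonalizes_eigenvalues P d A : diagonalizes P d A ->
  [/\ size (eigenvalues A) = k, sorted (fun x y : R => y <= x) (eigenvalues A),
      forall i, d 0 i \in eigenvalues A
    & forall a, a \in eigenvalues A -> exists i, a = d 0 i].
Proof.
move=> [PP ->]; have cA := char_poly_orthogonal_diag d PP.
set A' := P^T *m _ *m P in cA *.
have [srt charA] : sorted (fun x y : R => y <= x) (eigenvalues A') /\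
    char_poly A' = \prod_(a <- eigenvalues A') ('X - a%:P).
  apply: (@xgetPex _ [::] [set s : seq R | sorted (fun x y : R => y <= x) s /\
     char_poly A' = \prod_(a <- s) ('X - a%:P)]%classic).
  exists (sort (fun x y : R => y <= x) [seq d 0 i | i : 'I_k]); split.
    by apply: sort_sorted => x y; exact: le_total.
  rewrite cA (perm_big [seq d 0 i | i : 'I_k]) /=; last by rewrite perm_sort.
  by rewrite big_image.
have memE a : (a \in eigenvalues A') = [exists i, a == d 0 i].
  rewrite -root_prod_XsubC -charA cA.
  rewrite rootE horner_prod; apply/prodf_eq0/existsP => [[j]|[j]].
    by rewrite hornerXsubC subr_eq0; exists j.
  by exists j; rewrite // hornerXsubC subr_eq0.
split=> //.
- by have := size_char_poly A'; rewrite charA size_prod_XsubC => -[].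
- by move=> i; rewrite memE; apply/existsP; exists i.
- by move=> a; rewrite memE => /existsP [i /eqP]; exists i.
Qed.

Lemma symmetric_spectrum A : (0 < k)%N -> A^T = A ->
  exists P d, [/\ diagonalizes P d A,
    forall i, lambda k A <= d 0 i <= lambda 1 A,
    exists i, d 0 i = lambda 1 A & exists i, d 0 i = lambda k A].
Proof.
move=> k0 /symmetric_spectral [P [d PdA]]; exists P, d.
have [szA srt dA Ad] := diagonalizes_eigenvalues PdA.
have geR : transitive (fun x y : R => y <= x) by move=> y x z yx zy; apply: le_trans yx.
have lt_idx i : (index (d 0%R i) (eigenvalues A) < k)%N by rewrite -[X in (_ < X)%N]szA index_mem.
split=> //.
- move=> i; rewrite /lambda -(nth_index 0 (dA i)).
  have geRR : reflexive (fun x y : R => y <= x) by move=> x; apply: lexx.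
  have mono := sorted_leq_nth geR geRR 0 srt.
  by rewrite !mono ?inE ?szA ?prednK// -ltnS prednK.
- have lA : lambda 1 A \in eigenvalues A by rewrite mem_nth ?szA.
  by have [i ->] := Ad _ lA; exists i.
- have lA : lambda k A \in eigenvalues A by rewrite mem_nth ?szA ?prednK.
  by have [i ->] := Ad _ lA; exists i.
Qed.

(** In the orthonormal coordinates P x, the form of A and its square are
    diagonal; every Rayleigh-type bound is then a termwise comparison. *)
Lemma dot_diag P d A x : diagonalizes P d A ->
  [/\ dot x x = \sum_i (P *m x) i 0 ^+ 2,
      dot x (A *m x) = \sum_i d 0 i * (P *m x) i 0 ^+ 2
    & dot (A *m x) (A *m x) = \sum_i d 0 i ^+ 2 * (P *m x) i 0 ^+ 2].
Proof.
move=> [PP ->]; have PPT := mulmx1C PP.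
have H y z : dot (P^T *m y) (P^T *m z) = dot y z.
  by rewrite dot_mulmxl trmxK mulmxA PPT mul1mx.
have DE i : (diag_mx d *m (P *m x)) i 0 = d 0 i * (P *m x) i 0 by rewrite mul_diag_mx !mxE.
have xE : x = P^T *m (P *m x) by rewrite mulmxA PP mul1mx.
split; rewrite -?mulmxA.
- by rewrite {1 2}xE H dotE.
- rewrite {1}xE H dotE; apply: eq_bigr => i _; rewrite DE; ring.
- rewrite H dotE; apply: eq_bigr => i _; rewrite DE; ring.
Qed.

Lemma diagonalizes_eigenvector P d A i : diagonalizes P d A ->
  exists2 v : 'cV[R]_k, v != 0 & A *m v = d 0 i *: v.
Proof.
move=> [PP ->]; have PPT := mulmx1C PP; exists (P^T *m delta_mx i 0).
  apply/eqP => v0; have := congr1 (mulmx P) v0; rewrite mulmxA PPT mul1mx mulmx0.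
  by move/colP/(_ i); rewrite !mxE !eqxx; apply/eqP; rewrite oner_eq0.
rewrite -mulmxA (mulmxA P) PPT mul1mx -mulmxA scalemxAr; congr (_ *m _).
apply/colP => j; rewrite mul_diag_mx !mxE.
by have [->//|_] := eqVneq j i; rewrite !mulr0.
Qed.

Section Rayleigh.
Variable A : 'M[R]_k.
Hypotheses (k0 : (0 < k)%N) (sA : A^T = A).

Lemma lambda1_eigenvector : exists2 v : 'cV[R]_k, v != 0 & A *m v = lambda 1 A *: v.
Proof.
have [P [d [PdA _ [i <-] _]]] := symmetric_spectrum k0 sA.
exact: diagonalizes_eigenvector PdA.
Qed.

Lemma lambdak_eigenvector : exists2 v : 'cV[R]_k, v != 0 & A *m v = lambda k A *: v.
Proof.
have [P [d [PdA _ _ [i <-]]]] := symmetric_spectrum k0 sA.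
exact: diagonalizes_eigenvector PdA.
Qed.

Lemma rayleigh_le x : dot x (A *m x) <= lambda 1 A * dot x x.
Proof.
have [P [d [PdA bd _ _]]] := symmetric_spectrum k0 sA.
have [-> -> _] := dot_diag x PdA; rewrite mulr_sumr; apply: ler_sum => i _.
by rewrite ler_wpM2r ?sqr_ge0//; case/andP: (bd i).
Qed.

Lemma rayleigh_ge x : lambda k A * dot x x <= dot x (A *m x).
Proof.
have [P [d [PdA bd _ _]]] := symmetric_spectrum k0 sA.
have [-> -> _] := dot_diag x PdA; rewrite mulr_sumr; apply: ler_sum => i _.
by rewrite ler_wpM2r ?sqr_ge0//; case/andP: (bd i).
Qed.
End Rayleigh.

(** * Positive definite matrices *)

Lemma spd_form A : spd A <-> A^T = A /\ forall x, x != 0 -> 0 < dot x (A *m x).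
Proof. by split=> -[sA pA]; split=> // x /pA; rewrite /dot mulmxA. Qed.

Lemma spd_lambda_gt0 A : (0 < k)%N -> spd A -> 0 < lambda k A.
Proof.
move=> k0 /spd_form [sA pA]; have [v v0 Av] := lambdak_eigenvector k0 sA.
by have := pA v v0; rewrite Av dotZr pmulr_lgt0 ?dot_gt0.
Qed.

Lemma lambdak_le_lambda1 A : (0 < k)%N -> A^T = A -> lambda k A <= lambda 1 A.
Proof.
move=> k0 sA; have [P [d [_ bd [i _] _]]] := symmetric_spectrum k0 sA.
by case/andP: (bd i); exact: le_trans.
Qed.

Lemma spd_unit A : spd A -> A \in unitmx.
Proof.
move=> /spd_form [sA pA]; rewrite -unitmx_tr -row_free_unit -kermx_eq0.
apply: contraT => /rowV0Pn [v /sub_kermxP vA v0].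
have /pA : v^T != 0 by rewrite trmx_eq0.
by rewrite -[A]trmxK -trmx_mul vA trmx0 dotC dot0l ltxx.
Qed.

(** * Spectral norm and condition number *)

Lemma vnorm2E x : vnorm2 x = Num.sqrt (dot x x).
Proof. by rewrite /vnorm2 dotE; congr Num.sqrt; apply: eq_bigr => i _. Qed.

Lemma mxnorm2_eq A (c : R) (v : 'cV[R]_k) : 0 <= c ->
  (forall x, dot (A *m x) (A *m x) <= c ^+ 2 * dot x x) ->
  v != 0 -> A *m v = c *: v -> mxnorm2 A = c.
Proof.
move=> c0 Ac v0 Av; have vv : 0 < dot v v by rewrite dot_gt0.
have ub x : vnorm2 x = 1 -> vnorm2 (A *m x) <= c.
  rewrite !vnorm2E => x1; rewrite -(ger0_norm c0) -sqrtr_sqr ler_wsqrtr//.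
  rewrite (le_trans (Ac x))// -[dot x x]sqr_sqrtr ?dot_ge0// x1 expr1n mulr1//.
pose u := (Num.sqrt (dot v v))^-1 *: v.
have u1 : vnorm2 u = 1.
  rewrite vnorm2E dotZl dotZr mulrA -invfM -expr2 sqr_sqrtr ?ltW// mulVf ?sqrtr1//.
  by rewrite gt_eqF.
have uc : vnorm2 (A *m u) = c.
  have -> : A *m u = c *: u by rewrite -scalemxAr Av !scalerA mulrC.
  by rewrite vnorm2E dotZl dotZr mulrA -expr2 sqrtrM ?sqr_ge0// 
    sqrtr_sqr ger0_norm// -vnorm2E u1 mulr1.
apply/eqP; rewrite eq_le; apply/andP; split.
  apply: ge_sup; first by exists (vnorm2 (A *m u)); exists u.
  by move=> _ [x /= x1 <-]; exact: ub.
apply: ub_le_sup; last by exists u.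
by exists c => _ [x /= x1 <-]; exact: ub.
Qed.

(** The norm of A is its largest eigenvalue, as the entries of its diagonal
    form are positive. For the inverse, the bound |A^-1 y| <= |y| / lambda_k is
    the lower bound lambda_k |x| <= |A x| read at x = A^-1 y. *)
Theorem cond2_spd A : (0 < k)%N -> spd A -> cond2 A = lambda 1 A / lambda k A.
Proof.
move=> k0 pA; have [sA _] := pA; have lk := spd_lambda_gt0 k0 pA.
have AU := spd_unit pA.
have [P [d [PdA bd _ _]]] := symmetric_spectrum k0 sA.
have l1 : 0 < lambda 1 A by apply: lt_le_trans (lambdak_le_lambda1 k0 sA).
congr (_ * _).
  have [v v0 Av] := lambda1_eigenvector k0 sA.
  apply: mxnorm2_eq v0 Av; first exact: ltW.
  move=> x; have [-> _ ->] := dot_diag x PdA; rewrite mulr_sumr.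
  apply: ler_sum => i _; rewrite ler_wpM2r ?sqr_ge0// ler_sqr ?nnegrE ?(ltW l1)//.
    by case/andP: (bd i).
  by case/andP: (bd i) => di _; rewrite (le_trans (ltW lk)).
have [v v0 Av] := lambdak_eigenvector k0 sA.
apply: (mxnorm2_eq (v := v)) => //; first by rewrite invr_ge0 ltW.
  move=> y; pose x := invmx A *m y; have -> : y = A *m x by rewrite mulKVmx.
  rewrite mulKmx// exprVn ler_pdivlMl ?exprn_gt0//.
  have [-> _ ->] := dot_diag x PdA; rewrite mulr_sumr.
  apply: ler_sum => i _; rewrite ler_wpM2r ?sqr_ge0// ler_sqr ?nnegrE ?(ltW lk)//.
    by case/andP: (bd i).
  by case/andP: (bd i) => di _; rewrite (le_trans (ltW lk)).
apply: (can_inj (mulKmx AU)); rewrite mulKVmx// -scalemxAr Av scalerA mulVf ?scale1r//.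
by rewrite gt_eqF.
Qed.

(** * Square roots and block diagonal matrices *)

(** A square root is built by taking roots on the diagonal, so the default value
    of [spd_sqrt] is never reached. *)
Lemma spd_sqrtP A : (0 < k)%N -> spd A -> spd (spd_sqrt A) /\ spd_sqrt A *m spd_sqrt A = A.
Proof.
move=> k0 pA; have [sA _] := pA; have lk := spd_lambda_gt0 k0 pA.
have [P [d [PdA bd _ _]]] := symmetric_spectrum k0 sA.
have d0 i : 0 < d 0 i by case/andP: (bd i) => + _; exact: lt_le_trans.
pose r : 'rV[R]_k := \row_i Num.sqrt (d 0 i); pose C := P^T *m diag_mx r *m P.
have PrC : diagonalizes P r C by split=> //; case: PdA.
apply: (@xgetPex _ (0 : 'M[R]_k) [set C : 'M[R]_k | spd C /\ C *m C = A]%classic).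
exists C; split; last first.
  case: PdA => PP ->; rewrite /C -!mulmxA (mulmxA P) (mulmx1C PP) mul1mx.
  congr (_ *m _); rewrite !mulmxA; congr (_ *m _); rewrite mulmx_diag.
  by congr diag_mx; apply/rowP => i; rewrite !mxE -expr2 sqr_sqrtr// ltW.
apply/spd_form; split; first by rewrite /C !trmx_mul trmxK tr_diag_mx mulmxA.
move=> x; rewrite -dot_gt0 => xx; have [xE -> _] := dot_diag x PrC.
apply: lt_le_trans (_ : Num.sqrt (lambda k A) * dot x x <= _).
  by rewrite mulr_gt0 ?sqrtr_gt0.
rewrite xE mulr_sumr; apply: ler_sum => i _; rewrite ler_wpM2r ?sqr_ge0//.
by rewrite mxE ler_wsqrtr//; case/andP: (bd i).
Qed.

End Spectrum.

Lemma spd_mxdiag (R : realType) n (p_ : 'I_n -> nat) (D : forall i, 'M[R]_(p_ i)) :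
  (forall i, spd (D i)) -> spd (\mxdiag_i D i).
Proof.
move=> pD; apply/spd_form; split.
  by rewrite tr_mxdiag; apply: eq_mxdiag => i; case: (pD i).
move=> x; rewrite -[x]submxcolK => x0.
rewrite /dot mul_mxdiag_mxcol tr_mxcol mul_mxrow_mxcol summxE.
have q0 i : 0 <= dot (submxcol x i) (D i *m submxcol x i).
  have [->|xi] := eqVneq (submxcol x i) 0; first by rewrite dot0l.
  by have /spd_form[_ /(_ _ xi)/ltW] := pD i.
rewrite lt_def sumr_ge0 => [|i _]; last exact: q0.
rewrite andbT; apply: contra x0 => /eqP /psumr_eq0P H; apply/eqP.
rewrite -mxcol0; apply: eq_mxcol => i; apply/eqP; apply: contraT => xi.
have /spd_form[_ /(_ _ xi)] := pD i; rewrite [X in 0 < X]H ?ltxx// => j _; exact: q0.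
Qed.

(** * The preconditioned Hessian *)

Section Hessian.
Context {R : realType} {N p : nat}.
Variables (B : 'M[R]_N) (Rh : 'M[R]_p) (H : 'M[R]_(p, N)).
Hypotheses (N0 : (0 < N)%N) (p0 : (0 < p)%N) (pN : (p < N)%N).
Hypotheses (pB : spd B) (pR : spd Rh).
Let L := spd_sqrt B.
Let G := H^T *m invmx Rh *m H.
Let K := H *m B *m H^T.
Let S := precond_hessian B Rh H.

Lemma sqrt_sym : L^T = L.
Proof. by have [[]] := spd_sqrtP N0 pB. Qed.

Lemma sqrt_sqr : L *m L = B.
Proof. by have [] := spd_sqrtP N0 pB. Qed.

Lemma obs_cov_inv_sym : (invmx Rh)^T = invmx Rh.
Proof. by rewrite trmx_inv; case: pR => ->. Qed.

Lemma gram_sym : G^T = G.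
Proof. by rewrite !trmx_mul trmxK obs_cov_inv_sym mulmxA. Qed.

Lemma outer_sym : K^T = K.
Proof. by rewrite !trmx_mul trmxK; case: pB => ->; rewrite mulmxA. Qed.

Lemma hessianE : S = 1%:M + L *m G *m L.
Proof. by rewrite /S /precond_hessian /G !mulmxA. Qed.

Lemma hessian_sym : S^T = S.
Proof.
rewrite hessianE linearD /= trmx1 (trmx_mul (L *m G)) (trmx_mul L).
by rewrite sqrt_sym gram_sym mulmxA.
Qed.

Lemma sandwich_form x : dot x (L *m G *m L *m x) = dot (L *m x) (G *m (L *m x)).
Proof. by rewrite dot_mulmxl sqrt_sym !mulmxA. Qed.

Lemma hessian_form x : dot x (S *m x) = dot x x + dot (L *m x) (G *m (L *m x)).
Proof. by rewrite hessianE mulmxDl mul1mx dotDr sandwich_form. Qed.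

Lemma background_form x : dot x (B *m x) = dot (L *m x) (L *m x).
Proof. by rewrite dot_mulmxl sqrt_sym mulmxA sqrt_sqr. Qed.

Lemma outer_form y : dot y (K *m y) = dot (L *m (H^T *m y)) (L *m (H^T *m y)).
Proof. by rewrite -background_form dot_mulmxl trmxK !mulmxA. Qed.

(** The substitution y = Rh^-1 z turns z^T Rh^-1 z into y^T Rh y, so positivity
    of G reduces to positivity of Rh. *)
Lemma gram_form x :
  dot x (G *m x) = dot (invmx Rh *m (H *m x)) (Rh *m (invmx Rh *m (H *m x))).
Proof.
rewrite mulKVmx ?spd_unit// dot_mulmxl obs_cov_inv_sym dot_mulmxl.
by rewrite !mulmxA.
Qed.

Lemma gram_ge0 x : 0 <= dot x (G *m x).
Proof.
rewrite gram_form; set y := invmx _ *m _.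
have [->|y0] := eqVneq y 0; first by rewrite dot0l.
by have /spd_form [_ /(_ _ y0)/ltW] := pR.
Qed.

Lemma hessian_spd : spd S.
Proof.
apply/spd_form; split; first exact: hessian_sym.
by move=> x x0; rewrite hessian_form ltr_wpDr ?gram_ge0 ?dot_gt0.
Qed.

(** The value 1 is attained on the kernel of H L, which is nonzero because the
    rank of H L is at most p < N. *)
Lemma hessian_lambda_min : lambda N S = 1.
Proof.
have [v v0 Sv] := lambdak_eigenvector N0 hessian_sym.
apply/eqP; rewrite eq_le; apply/andP; split; last first.
  have vv : 0 < dot v v by rewrite dot_gt0.
  by rewrite -(ler_pM2r vv) mul1r -dotZr -Sv hessian_form lerDl gram_ge0.
have [w w0 Hw] : exists2 w : 'cV[R]_N, w != 0 & H *m L *m w = 0.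
  have : kermx (H *m L)^T != 0.
    by rewrite kermx_eq0 /row_free neq_ltn (leq_ltn_trans (rank_leq_col _) pN).
  move/rowV0Pn => [u /sub_kermxP uHL u0]; exists u^T; rewrite ?trmx_eq0//.
  by apply: trmx_inj; rewrite trmx_mul trmxK uHL trmx0.
have ww : 0 < dot w w by rewrite dot_gt0.
have := rayleigh_ge N0 hessian_sym w.
rewrite hessian_form gram_form mulmxA Hw mulmx0 dot0l addr0.
by rewrite -{2}[dot w w]mul1r ler_pM2r.
Qed.

Theorem cond2_hessian : cond2 S = lambda 1 S.
Proof. by rewrite (cond2_spd N0 hessian_spd) hessian_lambda_min divr1. Qed.

(** The largest eigenvalue of L G L, by [mu_attained] and [gram_form_le]. *)
Let mu := lambda 1 S - 1.

Lemma mu_ge0 : 0 <= mu.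
Proof. by rewrite subr_ge0 -hessian_lambda_min lambdak_le_lambda1// hessian_sym. Qed.

Lemma gram_form_le x : dot (L *m x) (G *m (L *m x)) <= mu * dot x x.
Proof.
have := rayleigh_le N0 hessian_sym x.
by rewrite hessian_form /mu mulrBl mul1r lerBrDl.
Qed.

Lemma mu_attained : exists2 v : 'cV[R]_N, v != 0 & L *m G *m L *m v = mu *: v.
Proof.
have [v v0 Sv] := lambda1_eigenvector N0 hessian_sym; exists v => //.
by rewrite scalerBl scale1r -Sv hessianE mulmxDl mul1mx addrC addKr.
Qed.

Lemma gram_lambda1_ge0 : 0 <= lambda 1 G.
Proof.
have [u u0 Gu] := lambda1_eigenvector N0 gram_sym.
have := gram_ge0 u; rewrite Gu dotZr pmulr_lge0 ?dot_gt0//.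
Qed.

Lemma mu_le_product : mu <= lambda 1 B * lambda 1 G.
Proof.
have [v v0 Sv] := mu_attained; have vv : 0 < dot v v by rewrite dot_gt0.
rewrite -(ler_pM2r vv) -dotZr -Sv sandwich_form.
apply: le_trans (rayleigh_le N0 gram_sym _) _.
rewrite -background_form [lambda 1 B * _]mulrC -mulrA ler_wpM2l ?gram_lambda1_ge0//.
by apply: rayleigh_le => //; case: pB.
Qed.

Lemma product_le_mu : lambda 1 G * lambda N B <= mu.
Proof.
have [u u0 Gu] := lambda1_eigenvector N0 gram_sym.
have [pL _] := spd_sqrtP N0 pB; have LU := spd_unit pL.
pose v := invmx L *m u; have Lv : L *m v = u by rewrite mulKVmx.
have vv : 0 < dot v v.
  by rewrite dot_gt0; apply: contra u0 => /eqP v0; rewrite -Lv v0 mulmx0.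
rewrite -(ler_pM2r vv); apply: le_trans (gram_form_le v).
rewrite Lv Gu dotZr -mulrA ler_wpM2l ?gram_lambda1_ge0// -Lv -background_form.
by apply: rayleigh_ge => //; case: pB.
Qed.

(** Put x = L H^T y, so that y^T K y = |x|^2, and w = Rh^-1 H L x. Then
    y^T Rh w = y^T H L x = |x|^2, while w^T Rh w = x^T L G L x <= mu |x|^2. The
    Cauchy-Schwarz inequality for Rh would give
    |x|^4 <= (y^T Rh y) (mu |x|^2), hence the claim. *)
Lemma outer_form_le y : dot y (K *m y) <= mu * dot y (Rh *m y).
Proof.
set x := L *m (H^T *m y); set w := invmx Rh *m (H *m (L *m x)).
have [sR /spd_form[_ R0]] := (proj1 pR, pR).
have q0 z : 0 <= dot z (Rh *m z).
  by have [->|z0] := eqVneq z 0; [rewrite dot0l|exact: ltW (R0 z z0)].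
have wle : dot w (Rh *m w) <= mu * dot x x.
  by rewrite -gram_form; exact: gram_form_le.
have cross : dot y (Rh *m w) = dot x x.
  by rewrite mulKVmx ?spd_unit// {2}/x dot_mulmxl sqrt_sym dot_mulmxl trmxK dotC.
rewrite outer_form -/x.
have := mu_ge0; rewrite le_eqVlt => /predU1P [mu0|mupos].
  have w0 : w = 0.
    apply/eqP; apply: contraT => /R0; rewrite ltNge => /negP; case.
    by rewrite (le_trans wle)// -mu0 mul0r.
  by rewrite -cross w0 mulmx0 dotC dot0l -mu0 mul0r.
(* Cauchy-Schwarz in expanded form: positivity of Rh at mu y - w is exactly
   mu^2 y^T Rh y - 2 mu |x|^2 + w^T Rh w >= 0, and the last term is at most
   mu |x|^2. *)
have := q0 (mu *: y - w); rewrite mulmxBr -scalemxAr dotBl !dotBr !dotZl !dotZr.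
have -> : dot w (Rh *m y) = dot x x by rewrite -cross dotC dot_mulmxl sR.
rewrite cross => Hq; rewrite -(ler_pM2l mupos).
lra.
Qed.

Let lp0 : 0 < lambda p Rh := spd_lambda_gt0 p0 pR.
Let sR : Rh^T = Rh := proj1 pR.

Lemma outer_lambda1_le : lambda 1 K / lambda 1 Rh <= mu.
Proof.
have l1 : 0 < lambda 1 Rh by apply: lt_le_trans lp0 (lambdak_le_lambda1 p0 sR).
have [y y0 Ky] := lambda1_eigenvector p0 outer_sym.
have yy : 0 < dot y y by rewrite dot_gt0.
rewrite ler_pdivrMr// -(ler_pM2r yy) -dotZr -Ky.
apply: le_trans (outer_form_le y) _; rewrite -mulrA ler_wpM2l ?mu_ge0//.
exact: rayleigh_le.
Qed.

Lemma outer_lambdap_le : lambda p K / lambda p Rh <= mu.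
Proof.
have [y y0 Ry] := lambdak_eigenvector p0 sR.
have yy : 0 < dot y y by rewrite dot_gt0.
rewrite ler_pdivrMr// -(ler_pM2r yy) -mulrA -(dotZr (lambda p Rh)) -Ry.
by apply: le_trans (outer_form_le y); apply: rayleigh_ge outer_sym _.
Qed.

(** For v a top eigenvector of L G L and y = Rh^-1 H L v, one has
    L H^T y = L G L v = mu v. So y^T K y = mu^2 |v|^2 and
    y^T Rh y = mu |v|^2, and the Rayleigh bounds for K and Rh at y give
    mu^2 |v|^2 <= (lambda_1 K / lambda_p Rh) mu |v|^2. *)
Lemma mu_le_outer : mu <= lambda 1 K / lambda p Rh.
Proof.
have [v v0 Sv] := mu_attained; have vv : 0 < dot v v by rewrite dot_gt0.
pose y := invmx Rh *m (H *m (L *m v)).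
have LHy : L *m (H^T *m y) = mu *: v by rewrite -Sv /y /G !mulmxA.
have Ry : dot y (Rh *m y) = mu * dot v v.
  by rewrite -gram_form -sandwich_form Sv dotZr.
have Ky : dot y (K *m y) = mu ^+ 2 * dot v v.
  by rewrite outer_form LHy dotZl dotZr; ring.
have K1 := rayleigh_le p0 outer_sym y.
have Rp := rayleigh_ge p0 sR y.
have l1 : 0 <= lambda 1 K.
  have [z z0 Kz] := lambda1_eigenvector p0 outer_sym.
  have := dot_ge0 (L *m (H^T *m z)).
  by rewrite -outer_form Kz dotZr pmulr_lge0 ?dot_gt0.
rewrite ler_pdivlMr//.
have := mu_ge0; rewrite le_eqVlt => /predU1P [<-|mupos]; first by rewrite mul0r.
rewrite -(ler_pM2r (mulr_gt0 mupos vv)).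
have -> : mu * lambda p Rh * (mu * dot v v) = lambda p Rh * dot y (K *m y).
  by rewrite Ky; ring.
rewrite -Ry; apply: le_trans (ler_wpM2l (ltW lp0) K1) _.
by rewrite mulrCA ler_wpM2l.
Qed.

End Hessian.

Unset Implicit Arguments.

Theorem theorem4 (R : realType) (N n : nat) (p_ : 'I_n.+1 -> nat)
    (B : 'M[R]_N)
    (Robs : forall i : 'I_n.+1, 'M[R]_(p_ i))
    (H : forall i : 'I_n.+1, 'M[R]_(p_ i, N))
    (M : nat -> 'M[R]_N) :
  let p := (\sum_(i < n.+1) p_ i)%N in
  let Hh : 'M[R]_(p, N) := gen_obs_op H M in
  let Rh : 'M[R]_p := gen_obs_cov Robs in
  let S : 'M[R]_N := precond_hessian B Rh Hh in
  (0 < N)%N -> (0 < p)%N -> (p < N)%N ->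
  spd B -> (forall i : 'I_n.+1, spd (Robs i)) ->
  1 + Num.max (lambda 1 (Hh^T *m invmx Rh *m Hh) * lambda N B)
        (Num.max (lambda 1 (Hh *m B *m Hh^T) / lambda 1 Rh)
                 (lambda p (Hh *m B *m Hh^T) / lambda p Rh))
    <= cond2 S
  /\
  cond2 S <=
    1 + Num.min (lambda 1 B * lambda 1 (Hh^T *m invmx Rh *m Hh))
                (lambda 1 (Hh *m B *m Hh^T) / lambda p Rh).
Proof.
move=> p Hh Rh S N0 p0 pN pB pRobs; have pR : spd Rh by exact: spd_mxdiag.
rewrite cond2_hessian//; split.
  by rewrite -lerBrDl !ge_max product_le_mu// outer_lambda1_le// outer_lambdap_le.
by rewrite -lerBlDl le_min mu_le_product// mu_le_outer.
Qed.
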